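(* Under the normal-play convention, the dicot universe $\mathbb{D}$ is, up to indistinguishability, the single proper absolute universe. That is: $\mathbb{D}$ is an absolute universe and $\Omega$ is a proper extension of $\mathbb{D}$; and every absolute universe $\mathbb{U}\subseteq\Omega$ such that $\Omega$ is a proper extension of $\mathbb{U}$ satisfies $\mathbb{D}\subseteq\mathbb{U}$ and $\mathbb{D}\simeq\mathbb{U}$.
   Context: Game forms: $\Omega$ is the set of all short (finite, loop-free) partizan game forms $G=\{G^{\mathcal L}\mid G^{\mathcal R}\}$, built recursively from $\mathbf 0=\{\varnothing\mid\varnothing\}$, where $G^{\mathcal L}, G^{\mathcal R}$ are finite (possibly empty) sets of previously built forms (the Left and Right options). Forms are not identified under any equivalence. A follower of $G$ is any form reachable from $G$ by a (possibly empty, not necessarily alternating) sequence of moves. The disjunctive sum is $G+H=\{G^{\mathcal L}+H,\,G+H^{\mathcal L}\mid G^{\mathcal R}+H,\,G+H^{\mathcal R}\}$, and the conjugate of $G$ is obtained by recursively swapping the roles of Left and Right. Universe: a set $\mathbb{U}\subseteq\Omega$ is a universe if $\mathbf 0\in\mathbb{U}$ and $\mathbb{U}$ is closed under disjunctive sum, under conjugation, and under taking options. It is parental if for all finite non-empty sets $\mathcal G,\mathcal H\subseteq\mathbb{U}$ the form $\{\mathcal G\mid\mathcal H\}$ belongs to $\mathbb{U}$. An absolute universe is a parental universe (the further requirement of ''outcome saturation'' is a consequence of parentality). Dicot: $G$ is a dicot if ($G^{\mathcal L}=\varnothing\Leftrightarrow G^{\mathcal R}=\varnothing$) and all options of $G$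 are dicots; $\mathbb{D}$ is the set of all dicots. Normal-play: players alternate, and a player who cannot move on their turn loses. The outcome $o(G)\in\{\mathscr L,\mathscr R,\mathscr N,\mathscr P\}$ records whether, under optimal play, Left wins no matter who starts, Right wins no matter who starts, the next (starting) player wins, or the previous (second) player wins. Distinguishability: for a universe $\mathbb{U}$, forms $G,H\in\mathbb{U}$ are distinguishable modulo $\mathbb{U}$ if there is $X\in\mathbb{U}$ with $o(G+X)\neq o(H+X)$. For universes $\mathbb{U}\subseteq\mathbb{U}'$, $\mathbb{U}'$ is a proper extension of $\mathbb{U}$ if there is $G\in\mathbb{U}'$ such that for all $H\in\mathbb{U}$, $G$ and $H$ are distinguishable modulo $\mathbb{U}'$. If $\mathbb{U}\subseteq\mathbb{U}'$ and $\mathbb{U}'$ is not a proper extension of $\mathbb{U}$, one writes $\mathbb{U}\simeq\mathbb{U}'$. *)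

(* Defs.v *)
From HB Require Import structures.
From mathcomp Require Import all_boot.
From mathcomp Require Import finmap.

Set Implicit Arguments.
Unset Strict Implicit.
Unset Printing Implicit Defensive.

Local Open Scope fset_scope.

(* Game forms are hereditarily finite: the options of a form are finite sets
   of forms. They are realised as the trees in which every list of options is
   the canonical enumeration of a finite set, so that Leibniz equality on
   [form] is identity of forms. The interface is [Form], [lopts], [ropts],
   [lopts_Form], [ropts_Form], [form_eta], [form_inj] and [form_ind]; together
   they say that [form] is the initial solution of
   form = {fset form} * {fset form}. *)

Inductive tree := Node of seq tree & seq tree.

Fixpoint tree_encode (t : tree) : GenTree.tree void :=
  let: Node l r := t in
  GenTree.Node 0 [:: GenTree.Node 0 (map tree_encode l);
                     GenTree.Node 0 (map tree_encode r)].

Fixpoint tree_decode (t : GenTree.tree void) : tree :=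
  match t with
  | GenTree.Node _ [:: GenTree.Node _ l; GenTree.Node _ r] =>
      Node (map tree_decode l) (map tree_decode r)
  | _ => Node [::] [::]
  end.

Lemma tree_encodeK : cancel tree_encode tree_decode.
Proof.
rewrite /cancel; fix IH 1; case=> l r /=; congr Node; rewrite -map_comp.
- by elim: l => //= t l ->; rewrite IH.
- by elim: r => //= t r ->; rewrite IH.
Qed.

HB.instance Definition _ := Choice.copy tree (can_type tree_encodeK).

Fixpoint canonical_tree (t : tree) : bool :=
  let: Node l r := t in
  [&& canonical_keys l, canonical_keys r,
      all canonical_tree l & all canonical_tree r].

Definition form : Type := {t : tree | canonical_tree t}.

Definition tree_lopts (t : tree) := let: Node l _ := t in l.
Definition tree_ropts (t : tree) := let: Node _ r := t in r.

Definition lopts (G : form) : {fset form} :=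
  [fset x in (pmap insub (tree_lopts (val G)) : seq form)].
Definition ropts (G : form) : {fset form} :=
  [fset x in (pmap insub (tree_ropts (val G)) : seq form)].

Lemma canonical_Form (L R : {fset form}) :
  canonical_tree (Node (sort_keys (map val L)) (sort_keys (map val R))).
Proof.
rewrite /= !canonical_sort_keys /=; apply/andP; split; apply/allP => t;
  by rewrite sort_keysE => /mapP[x _ ->]; exact: (valP x).
Qed.

Definition Form (L R : {fset form}) : form :=
  exist (fun t => canonical_tree t) _ (canonical_Form L R).

Lemma lopts_Form (L R : {fset form}) : lopts (Form L R) = L.
Proof.
apply/fsetP => x; rewrite !inE /= mem_pmap_sub sort_keysE mem_map //.
exact: val_inj.
Qed.

Lemma ropts_Form (L R : {fset form}) : ropts (Form L R) = R.
Proof.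
apply/fsetP => x; rewrite !inE /= mem_pmap_sub sort_keysE mem_map //.
exact: val_inj.
Qed.

Lemma sort_keys_pmap (s : seq tree) (A : {fset form}) :
    canonical_keys s -> all canonical_tree s ->
    A =i (pmap insub s : seq form) ->
  sort_keys (map val A) = s.
Proof.
move=> /eqP cs /allP hs eqA; rewrite -[RHS]cs; apply/eq_sort_keys => t.
apply/mapP/idP => [[x xA ->]|ts].
  by move: xA; rewrite eqA mem_pmap_sub.
by exists (Sub t (hs t ts)); rewrite ?SubK // eqA mem_pmap_sub SubK.
Qed.

Lemma form_eta (G : form) : Form (lopts G) (ropts G) = G.
Proof.
apply: val_inj; case: G => -[l r] /= can; case/and4P: (can) => cl cr hl hr.
by congr Node; apply: sort_keys_pmap => // x; rewrite !inE.
Qed.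

Lemma form_inj (G H : form) :
  lopts G = lopts H -> ropts G = ropts H -> G = H.
Proof. by move=> eL eR; rewrite -[G]form_eta eL eR form_eta. Qed.

Fixpoint tree_height (t : tree) : nat :=
  let: Node l r := t in
  (foldr maxn 0 (map tree_height l) + foldr maxn 0 (map tree_height r)).+1.

Definition height (G : form) : nat := tree_height (val G).

Lemma leq_foldr_max (f : tree -> nat) (s : seq tree) t :
  t \in s -> f t <= foldr maxn 0 (map f s).
Proof.
elim: s => //= u s IH; rewrite inE leq_max => /orP[/eqP->|/IH->].
  by rewrite leqnn.
by rewrite orbT.
Qed.

Lemma height_lopt (G x : form) : x \in lopts G -> height x < height G.
Proof.
rewrite !inE mem_pmap_sub /height; case: (val G) => l r /= xl.
by rewrite ltnS (leq_trans (leq_foldr_max _ xl)) ?leq_addr.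
Qed.

Lemma height_ropt (G x : form) : x \in ropts G -> height x < height G.
Proof.
rewrite !inE mem_pmap_sub /height; case: (val G) => l r /= xr.
by rewrite ltnS (leq_trans (leq_foldr_max _ xr)) ?leq_addl.
Qed.

Lemma form_ind (P : form -> Prop) :
    (forall G, (forall x, x \in lopts G -> P x) ->
               (forall x, x \in ropts G -> P x) -> P G) ->
  forall G, P G.
Proof.
move=> IH G; have [n] := ubnP (height G).
elim: n G => // n IHn G; rewrite ltnS => leGn.
apply: IH => x xG; apply: IHn.
- exact: leq_trans (height_lopt xG) leGn.
- exact: leq_trans (height_ropt xG) leGn.
Qed.

Definition game0 : form := Form fset0 fset0.

(* The recursive operations below take a recursion bound [n], set large enough
   to be irrelevant; [lopts_gadd], [ropts_gadd], [lopts_conjugate],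
   [ropts_conjugate] and [wins_firstE] are their defining equations. *)

Fixpoint gadd_rec (n : nat) (G H : form) : form :=
  if n is m.+1 then
    Form ([fset gadd_rec m x H | x in lopts G] `|`
          [fset gadd_rec m G y | y in lopts H])
         ([fset gadd_rec m x H | x in ropts G] `|`
          [fset gadd_rec m G y | y in ropts H])
  else game0.

Definition gadd (G H : form) : form := gadd_rec (height G + height H).+1 G H.

Fixpoint conjugate_rec (n : nat) (G : form) : form :=
  if n is m.+1 then
    Form [fset conjugate_rec m x | x in ropts G]
         [fset conjugate_rec m x | x in lopts G]
  else game0.

Definition conjugate (G : form) : form := conjugate_rec (height G).+1 G.

Inductive player := Left | Right.

Definition opponent (p : player) : player :=
  if p is Left then Right else Left.

Definition opts (p : player) (G : form) : {fset form} :=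
  if p is Left then lopts G else ropts G.

(* [wins_first p G]: under normal play, [p] wins [G] when moving first. *)
Fixpoint wins_first_rec (n : nat) (p : player) (G : form) : bool :=
  if n is m.+1 then
    has (fun x => ~~ wins_first_rec m (opponent p) x) (opts p G)
  else false.

Definition wins_first (p : player) (G : form) : bool :=
  wins_first_rec (height G).+1 p G.

Lemma height_opt (p : player) (G x : form) :
  x \in opts p G -> height x < height G.
Proof. by case: p; [exact: height_lopt | exact: height_ropt]. Qed.

Lemma eq_image (f g : form -> form) (A : {fset form}) :
    (forall x, x \in A -> f x = g x) ->
  [fset f x | x in A] = [fset g x | x in A].
Proof. by move=> eqfg; apply: eq_in_imfset => x; exact: eqfg. Qed.

Lemma gadd_rec_bound (n m : nat) (G H : form) :
    height G + height H < n -> height G + height H < m ->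
  gadd_rec n G H = gadd_rec m G H.
Proof.
elim: n m G H => // n IH [//|m] G H; rewrite !ltnS => ltn ltm /=.
have aL x : height x < height G -> gadd_rec n x H = gadd_rec m x H.
  rewrite -(ltn_add2r (height H)) => ltx.
  by apply: IH; [exact: leq_trans ltx ltn | exact: leq_trans ltx ltm].
have aR y : height y < height H -> gadd_rec n G y = gadd_rec m G y.
  rewrite -(ltn_add2l (height G)) => lty.
  by apply: IH; [exact: leq_trans lty ltn | exact: leq_trans lty ltm].
congr (Form (_ `|` _) (_ `|` _)); apply: eq_image => x xG.
- exact/aL/height_lopt.
- exact/aR/height_lopt.
- exact/aL/height_ropt.
- exact/aR/height_ropt.
Qed.

Lemma lopts_gadd (G H : form) :
  lopts (gadd G H) =
  [fset gadd x H | x in lopts G] `|` [fset gadd G y | y in lopts H].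
Proof.
rewrite {1}/gadd lopts_Form; congr (_ `|` _); apply: eq_image => x xG;
  apply: gadd_rec_bound; by rewrite // ?ltn_add2l ?ltn_add2r height_lopt.
Qed.

Lemma ropts_gadd (G H : form) :
  ropts (gadd G H) =
  [fset gadd x H | x in ropts G] `|` [fset gadd G y | y in ropts H].
Proof.
rewrite {1}/gadd ropts_Form; congr (_ `|` _); apply: eq_image => x xG;
  apply: gadd_rec_bound; by rewrite // ?ltn_add2l ?ltn_add2r height_ropt.
Qed.

Lemma conjugate_rec_bound (n m : nat) (G : form) :
  height G < n -> height G < m -> conjugate_rec n G = conjugate_rec m G.
Proof.
elim: n m G => // n IH [//|m] G; rewrite !ltnS => ltn ltm /=.
have a x : height x < height G -> conjugate_rec n x = conjugate_rec m x.
  by move=> ltx; apply: IH; [exact: leq_trans ltx ltn | exact: leq_trans ltx ltm].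
congr Form; apply: eq_image => x xG; first exact/a/height_ropt.
exact/a/height_lopt.
Qed.

Lemma lopts_conjugate (G : form) :
  lopts (conjugate G) = [fset conjugate x | x in ropts G].
Proof.
rewrite {1}/conjugate lopts_Form; apply: eq_image => x xG.
by apply: conjugate_rec_bound; rewrite // height_ropt.
Qed.

Lemma ropts_conjugate (G : form) :
  ropts (conjugate G) = [fset conjugate x | x in lopts G].
Proof.
rewrite {1}/conjugate ropts_Form; apply: eq_image => x xG.
by apply: conjugate_rec_bound; rewrite // height_lopt.
Qed.

Lemma wins_first_rec_bound (n m : nat) (p : player) (G : form) :
    height G < n -> height G < m ->
  wins_first_rec n p G = wins_first_rec m p G.
Proof.
elim: n m p G => // n IH [//|m] p G; rewrite !ltnS => ltn ltm /=.
apply: eq_in_has => x /height_opt ltx.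
by congr (~~ _); apply: IH; rewrite (leq_trans ltx).
Qed.

Lemma wins_firstE (p : player) (G : form) :
  wins_first p G = has (fun x => ~~ wins_first (opponent p) x) (opts p G).
Proof.
apply: eq_in_has => x xG; congr (~~ _).
by apply: wins_first_rec_bound; rewrite // (height_opt xG).
Qed.

Inductive outcome_class := OutL | OutR | OutN | OutP.

Definition outcome (G : form) : outcome_class :=
  match wins_first Left G, wins_first Right G with
  | true, false => OutL
  | false, true => OutR
  | true, true => OutN
  | false, false => OutP
  end.

Inductive dicot (G : form) : Prop :=
  Dicot of (lopts G = fset0 <-> ropts G = fset0)
    & (forall x, x \in lopts G -> dicot x)
    & (forall x, x \in ropts G -> dicot x).

Definition Omega (G : form) : Prop := True.

Definition included (U V : form -> Prop) : Prop := forall G, U G -> V G.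

Record universe (U : form -> Prop) : Prop := Universe {
  universe0 : U game0;
  universe_add : forall G H, U G -> U H -> U (gadd G H);
  universe_conjugate : forall G, U G -> U (conjugate G);
  universe_lopt : forall G x, U G -> x \in lopts G -> U x;
  universe_ropt : forall G x, U G -> x \in ropts G -> U x
}.

Definition parental (U : form -> Prop) : Prop :=
  forall A B : {fset form}, A <> fset0 -> B <> fset0 ->
    (forall x, x \in A -> U x) -> (forall x, x \in B -> U x) -> U (Form A B).

(* Outcome saturation is implied by parentality, hence not a separate field. *)
Definition absolute_universe (U : form -> Prop) : Prop :=
  universe U /\ parental U.

Definition distinguishable (U : form -> Prop) (G H : form) : Prop :=
  exists X, U X /\ outcome (gadd G X) <> outcome (gadd H X).

(* [proper_extension U V]: [V] is a proper extension of [U]. *)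
Definition proper_extension (U V : form -> Prop) : Prop :=
  included U V /\
  exists G, V G /\ forall H, U H -> distinguishable V G H.

(* [U] is identified with its extension [V] up to indistinguishability. *)
Definition indist_extension (U V : form -> Prop) : Prop :=
  included U V /\ ~ proper_extension U V.

(* Main.v *)
(* Normal play makes forms modulo indistinguishability a partially ordered
   group in which a form with no Left option is a nonpositive integer. If an
   absolute universe U contains a nonzero such integer, then parentality puts a
   form of value 1, hence all integers, in U; replacing the options of a form
   recursively then shows that every form is equivalent to a member of U, so
   that Omega is not a proper extension of U. Otherwise all forms of U that lack
   Left or Right options have value 0, and the same replacement turns every
   form of U into an equivalent dicot. Finally, Omega properly extends the
   dicots because each dicot is strictly less than 1. *)
Require Import Defs.
From mathcomp Require Import all_boot finmap.

Set Implicit Arguments.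
Unset Strict Implicit.
Unset Printing Implicit Defensive.

Local Open Scope fset_scope.

(** * Moves and winning, uniformly in the player *)

Lemma opponentK (p : player) : opponent (opponent p) = p.
Proof. by case: p. Qed.

(** [p] wins [G] moving second; in the usual order, [safe Left G] says G >= 0 and [safe Right G]
    says G <= 0. *)
Definition safe (p : player) (G : form) : bool :=
  ~~ wins_first (opponent p) G.

Lemma safe_opponent (p : player) (G : form) :
  safe (opponent p) G = ~~ wins_first p G.
Proof. by rewrite /safe opponentK. Qed.

Lemma wins_firstP (p : player) (G : form) :
  reflect (exists2 x, x \in opts p G & safe p x) (wins_first p G).
Proof. by rewrite wins_firstE; exact: hasP. Qed.

Lemma safeP (p : player) (G : form) :
  reflect (forall x, x \in opts (opponent p) G -> wins_first p x) (safe p G).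
Proof.
rewrite /safe wins_firstE -all_predC; apply: (iffP allP) => h x /h /=.
  by rewrite negbK opponentK.
by rewrite negbK opponentK.
Qed.

Lemma opts_Form (p : player) (A B : {fset form}) :
  opts p (Form A B) = if p is Left then A else B.
Proof. by case: p; rewrite /= ?lopts_Form ?ropts_Form. Qed.

Lemma opts_game0 (p : player) : opts p game0 = fset0.
Proof. by rewrite opts_Form; case: p. Qed.

Lemma opts_gadd (p : player) (G H : form) :
  opts p (gadd G H) =
  [fset gadd x H | x in opts p G] `|` [fset gadd G y | y in opts p H].
Proof. by case: p; [exact: lopts_gadd | exact: ropts_gadd]. Qed.

Lemma opts_gaddl (p : player) (G H x : form) :
  x \in opts p G -> gadd x H \in opts p (gadd G H).
Proof.
by move=> xG; rewrite opts_gadd inE (in_imfset _ (fun z => gadd z H)).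
Qed.

Lemma opts_gaddr (p : player) (G H y : form) :
  y \in opts p H -> gadd G y \in opts p (gadd G H).
Proof. by move=> yH; rewrite opts_gadd inE orbC in_imfset. Qed.

Lemma opts_gaddP (p : player) (G H z : form) :
  z \in opts p (gadd G H) ->
  (exists2 x, x \in opts p G & z = gadd x H) \/
  (exists2 y, y \in opts p H & z = gadd G y).
Proof.
by rewrite opts_gadd inE => /orP[] /imfsetP[x /= xG ->]; [left|right]; exists x.
Qed.

Lemma opts_inj (G H : form) : (forall p, opts p G = opts p H) -> G = H.
Proof. by move=> h; apply: form_inj; [exact: (h Left) | exact: (h Right)]. Qed.

Lemma opts_ind (P : form -> Prop) :
    (forall G, (forall p x, x \in opts p G -> P x) -> P G) ->
  forall G, P G.
Proof. by move=> IH; apply: form_ind => G hL hR; apply: IH => -[]. Qed.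

(** * Algebra of sums and conjugates, as identities of forms *)

Lemma gaddC (G H : form) : gadd G H = gadd H G.
Proof.
elim/opts_ind: G H => G IHG; elim/opts_ind => H IHH.
apply: opts_inj => p; rewrite !opts_gadd fsetUC; congr (_ `|` _);
  apply: eq_in_imfset => x /= xG; [exact: IHH xG | exact: IHG xG _].
Qed.

Lemma imfset_comp (f g : form -> form) (A : {fset form}) :
  [fset f x | x in [fset g y | y in A]] = [fset f (g y) | y in A].
Proof.
apply/fsetP => z; apply/imfsetP/imfsetP => /= [[x]|[y yA ->]].
  by move=> /imfsetP[y /= yA ->] ->; exists y.
by exists (g y); rewrite ?in_imfset.
Qed.

Lemma gaddA (G H K : form) : gadd G (gadd H K) = gadd (gadd G H) K.
Proof.
elim/opts_ind: G H K => G IHG; elim/opts_ind => H IHH; elim/opts_ind => K IHK.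
apply: opts_inj => p; rewrite !opts_gadd !imfsetU !imfset_comp fsetUA.
congr ((_ `|` _) `|` _); apply: eq_in_imfset => x /= xG.
- exact: IHG xG _ _.
- exact: IHH xG _.
- exact: IHK xG.
Qed.

Lemma gadd0 (G : form) : gadd G game0 = G.
Proof.
elim/opts_ind: G => G IH; apply: opts_inj => p.
rewrite opts_gadd opts_game0 imfset0 fsetU0.
rewrite -[RHS]imfset_id; apply: eq_in_imfset => x; exact: IH.
Qed.

Lemma gadd0l (G : form) : gadd game0 G = G.
Proof. by rewrite gaddC gadd0. Qed.

Lemma opts_conjugate (p : player) (G : form) :
  opts p (conjugate G) = [fset conjugate x | x in opts (opponent p) G].
Proof. by case: p; [exact: lopts_conjugate | exact: ropts_conjugate]. Qed.

Lemma conjugateK (G : form) : conjugate (conjugate G) = G.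
Proof.
elim/opts_ind: G => G IH; apply: opts_inj => p.
rewrite !opts_conjugate opponentK imfset_comp -[RHS]imfset_id.
apply: eq_in_imfset => x; exact: IH.
Qed.

Lemma conjugate_gadd (G H : form) :
  conjugate (gadd G H) = gadd (conjugate G) (conjugate H).
Proof.
elim/opts_ind: G H => G IHG; elim/opts_ind => H IHH.
apply: opts_inj => p.
rewrite opts_conjugate !opts_gadd !opts_conjugate imfsetU !imfset_comp.
congr (_ `|` _); apply: eq_in_imfset => x /= xG.
  exact: IHG xG _.
exact: IHH xG.
Qed.

Lemma wins_first_conjugate (p : player) (G : form) :
  wins_first p (conjugate G) = wins_first (opponent p) G.
Proof.
elim/opts_ind: G p => G IH p.
apply/wins_firstP/wins_firstP => [[y]|[x xG sx]].
  rewrite opts_conjugate => /imfsetP[x /= xG ->]; exists x => //.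
  by rewrite /safe -(IH _ _ xG).
exists (conjugate x); first by rewrite opts_conjugate in_imfset.
by rewrite /safe (IH _ _ xG).
Qed.

(** * Strategies in sums *)

(** The second player answers each move in the component where it was made. *)
Lemma safe_gadd (p : player) (G H : form) :
  safe p G -> safe p H -> safe p (gadd G H).
Proof.
have [n] := ubnP (height G + height H).
elim: n G H => // n IH G H; rewrite ltnS => le_n sG sH.
apply/safeP => z /opts_gaddP[] [x xG ->].
  have /wins_firstP[y yx sy] := safeP _ _ sG x xG.
  apply/wins_firstP; exists (gadd y H); first exact: opts_gaddl.
  apply: IH => //; apply: leq_trans le_n; rewrite ltn_add2r.
  exact: ltn_trans (height_opt yx) (height_opt xG).
have /wins_firstP[y yx sy] := safeP _ _ sH x xG.
apply/wins_firstP; exists (gadd G y); first exact: opts_gaddr.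
apply: IH => //; apply: leq_trans le_n; rewrite ltn_add2l.
exact: ltn_trans (height_opt yx) (height_opt xG).
Qed.

Lemma wins_first_gadd (p : player) (G H : form) :
  safe p G -> wins_first p H -> wins_first p (gadd G H).
Proof.
move=> sG /wins_firstP[y yH sy]; apply/wins_firstP.
by exists (gadd G y); [exact: opts_gaddr | exact: safe_gadd].
Qed.

Definition zero_game (G : form) : Prop := forall p, safe p G.

(** Mirror strategy: the second player copies each move, conjugated, in the other summand. *)
Lemma zero_game_conjugate (G : form) : zero_game (gadd G (conjugate G)).
Proof.
elim/opts_ind: G => G IH p.
apply/safeP => z /opts_gaddP[] [x xG ->]; apply/wins_firstP.
  exists (gadd x (conjugate x)); last exact: IH xG p.
  by apply: opts_gaddr; rewrite opts_conjugate in_imfset.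
move: xG; rewrite opts_conjugate opponentK => /imfsetP[y /= yG ->].
by exists (gadd y (conjugate y)); [exact: opts_gaddl | exact: IH yG p].
Qed.

(** * Equivalence and the group laws *)

(** The contexts [X] range over all forms, so equivalent forms are indistinguishable modulo every
    universe. *)
Definition equiv (G H : form) : Prop :=
  forall p X, wins_first p (gadd G X) = wins_first p (gadd H X).

Lemma equiv_refl (G : form) : equiv G G.
Proof. by []. Qed.

Lemma equiv_sym (G H : form) : equiv G H -> equiv H G.
Proof. by move=> e p X; rewrite e. Qed.

Lemma equiv_trans (G H K : form) : equiv G H -> equiv H K -> equiv G K.
Proof. by move=> e f p X; rewrite e. Qed.

Lemma equiv_gadd (G G' H H' : form) :
  equiv G G' -> equiv H H' -> equiv (gadd G H) (gadd G' H').
Proof.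
move=> e f p X.
by rewrite -gaddA e gaddA (gaddC G') -gaddA f gaddA (gaddC H').
Qed.

Lemma equiv_conjugate (G H : form) :
  equiv G H -> equiv (conjugate G) (conjugate H).
Proof.
move=> e p X; rewrite -(conjugateK X) -!conjugate_gadd !wins_first_conjugate.
exact: e.
Qed.

Lemma equiv_outcome (G H X : form) :
  equiv G H -> outcome (gadd G X) = outcome (gadd H X).
Proof. by move=> e; rewrite /outcome !e. Qed.

Lemma zero_game_equiv (G : form) : zero_game G -> equiv G game0.
Proof.
move=> zG p X; rewrite gadd0l; apply/idP/idP; last exact: wins_first_gadd.
(* If [p] loses [X] moving first, the opponent is safe in [X], hence also in [gadd G X]. *)
apply: contraTT; rewrite -!safe_opponent; exact: safe_gadd.
Qed.

(** Cancellation: G = G + (H - H) = (G + H) - H = -H, up to [equiv]. *)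
Lemma equiv_opposite (G H : form) :
  zero_game (gadd G H) -> equiv G (conjugate H).
Proof.
move=> /zero_game_equiv zGH.
have /zero_game_equiv zH := zero_game_conjugate H.
have := equiv_gadd (equiv_refl G) zH.
rewrite gaddA gadd0 => /equiv_sym /equiv_trans; apply.
by have := equiv_gadd zGH (equiv_refl (conjugate H)); rewrite gadd0l.
Qed.

(** Induction on the context suffices: a move in [G] or [H] is matched by an equivalent option,
    which is as good in every context. *)
Lemma equiv_opts (G H : form) :
    (forall p x, x \in opts p G -> exists2 y, y \in opts p H & equiv x y) ->
    (forall p y, y \in opts p H -> exists2 x, x \in opts p G & equiv x y) ->
  equiv G H.
Proof.
move=> hGH hHG p X; elim/opts_ind: X p => X IH p.
apply/wins_firstP/wins_firstP => -[z /opts_gaddP[] [x xG ->] sx].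
- have [y yH e] := hGH _ _ xG; exists (gadd y X); first exact: opts_gaddl.
  by rewrite /safe -e.
- by exists (gadd H x); [exact: opts_gaddr | rewrite /safe -(IH _ _ xG)].
- have [y yG e] := hHG _ _ xG; exists (gadd y X); first exact: opts_gaddl.
  by rewrite /safe e.
- by exists (gadd G x); [exact: opts_gaddr | rewrite /safe (IH _ _ xG)].
Qed.

(** Finite choice, by induction on [A]. The last clause keeps stray forms out of [B], as
    [equiv_opts] demands. *)
Lemma fset_choice (P : form -> Prop) (A : {fset form}) :
    (forall x, x \in A -> exists2 y, P y & equiv x y) ->
  exists B : {fset form}, [/\ forall y, y \in B -> P y,
    forall x, x \in A -> exists2 y, y \in B & equiv x y &
    forall y, y \in B -> exists2 x, x \in A & equiv x y].
Proof.
elim/fset1U_rect: A => [_|a A _ IH hA].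
  by exists fset0; split.
have [|B [BP AB BA]] := IH.
  by move=> x xA; apply: hA; rewrite inE xA orbT.
have [|b Pb eab] := hA a; first by rewrite inE in_fset1 eqxx.
exists (b |` B); split.
- by move=> y; rewrite in_fset1U => /orP[/eqP->|/BP].
- move=> x; rewrite in_fset1U => /orP[/eqP->|/AB[y yB e]].
    by exists b; rewrite // in_fset1U eqxx.
  by exists y; rewrite // in_fset1U yB orbT.
- move=> y; rewrite in_fset1U => /orP[/eqP->|/BA[x xA e]].
    by exists a; rewrite // in_fset1U eqxx.
  by exists x; rewrite // in_fset1U xA orbT.
Qed.

(** * Integers and ends *)

Fixpoint nat_form (n : nat) : form :=
  if n is m.+1 then Form [fset nat_form m] fset0 else game0.

Lemma lopts_nat_form (n : nat) (x : form) :
  x \in opts Left (nat_form n) -> exists2 m, n = m.+1 & x = nat_form m.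
Proof.
case: n => [|n]; first by rewrite opts_game0.
by rewrite opts_Form => /fset1P->; exists n.
Qed.

Lemma ropts_nat_form (n : nat) : opts Right (nat_form n) = fset0.
Proof. by case: n => [|n]; rewrite ?opts_game0 ?opts_Form. Qed.

(** An identity of forms, not only an equivalence: the Left options arising from the two summands
    coincide and merge in the option set. *)
Lemma nat_formS (n : nat) :
  gadd (nat_form 1) (nat_form n) = nat_form n.+1.
Proof.
elim: n => [|n IH]; first by rewrite gadd0.
apply: opts_inj => -[]; rewrite opts_gadd.
  by rewrite !opts_Form !imfset_fset1 gadd0l IH fsetUid.
by rewrite !ropts_nat_form !imfset0 fsetU0.
Qed.

Lemma safe_game0 (p : player) : safe p game0.
Proof. by apply/safeP => x; rewrite opts_game0. Qed.

Lemma conjugate_game0 : conjugate game0 = game0.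
Proof. by apply: opts_inj => p; rewrite opts_conjugate !opts_game0 imfset0. Qed.

Lemma opts_opp1 (p : player) :
  opts p (conjugate (nat_form 1)) = if p is Right then [fset game0] else fset0.
Proof.
by rewrite opts_conjugate opts_Form; case: p;
  rewrite /= ?imfset0 ?imfset_fset1 ?conjugate_game0.
Qed.

Lemma wins_first_Right_opp1 : wins_first Right (conjugate (nat_form 1)).
Proof.
by apply/wins_firstP; exists game0; rewrite ?safe_game0 // opts_opp1 fset11.
Qed.

(** Each Right move lowers the height of [G], so Left can answer every one of them with a free move
    of the integer. *)
Lemma safe_gadd_nat_form (n : nat) (G : form) :
  height G <= n -> safe Left (gadd G (nat_form n)).
Proof.
elim: n G => [|n IH] G leG; apply/safeP => z /opts_gaddP[] [x xG ->].
- by have := leq_trans (height_opt xG) leG.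
- by rewrite ropts_nat_form in xG.
- apply/wins_firstP; exists (gadd x (nat_form n)).
    by apply: opts_gaddr; rewrite opts_Form fset11.
  by apply: IH; rewrite -ltnS; exact: leq_trans (height_opt xG) leG.
- by rewrite ropts_nat_form in xG.
Qed.

(* The integer is minus the least [n] for which Left, moving second, survives
   in [G + n]: a Left option of [G + n] can only be [G + (n - 1)]. *)
Lemma left_end_equiv_nat_form (G : form) :
  opts Left G = fset0 -> exists n, equiv G (conjugate (nat_form n)).
Proof.
move=> G0; have exn : exists n, safe Left (gadd G (nat_form n)).
  by exists (height G); exact: safe_gadd_nat_form.
have [n sn minn] := ex_minnP exn; exists n; apply: equiv_opposite => -[//|].
apply/safeP => z /opts_gaddP[] [x].
  by rewrite G0.
move=> /lopts_nat_form[m en ->] ->; apply: contraT => /minn.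
by rewrite en ltnn.
Qed.

(** * Dicots *)

(** The two claims feed each other: after a move in [H], each follows from the other one for the
    option reached. If Right has no move in [H], then [H] is [game0] and Right moves from -1 to
    0. *)
Lemma dicot_lt_one (H : form) : dicot H ->
  safe Right (gadd H (conjugate (nat_form 1))) /\
  wins_first Right (gadd H (conjugate (nat_form 1))).
Proof.
elim/opts_ind: H => H IH [H0 dL dR]; split.
  apply/safeP => z /opts_gaddP[] [x xH ->].
    exact: proj2 (IH Left x xH (dL _ xH)).
  by rewrite opts_opp1 in xH.
have [R0|[x xH]] := fset_0Vmem (ropts H).
  have -> : H = game0.
    by apply: opts_inj => -[]; rewrite opts_game0 //; exact/H0.
  by rewrite gadd0l wins_first_Right_opp1.
apply/wins_firstP; exists (gadd x (conjugate (nat_form 1))).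
  exact: opts_gaddl.
exact: proj1 (IH Right x xH (dR _ xH)).
Qed.

Lemma imfset_eq0 (f : form -> form) (A : {fset form}) :
  ([fset f x | x in A] == fset0) = (A == fset0).
Proof.
have [->|[x xA]] := fset_0Vmem A; first by rewrite imfset0 eqxx.
have /fset0Pn/negbTE-> : exists y, y \in [fset f x | x in A].
  by exists (f x); exact: in_imfset.
by apply/esym/negbTE/fset0Pn; exists x.
Qed.

Lemma dicot_absolute : absolute_universe dicot.
Proof.
split; first split.
- by split=> [|x|x]; rewrite ?lopts_Form ?ropts_Form.
- elim/opts_ind => G IHG; elim/opts_ind => H IHH dG dH.
  case: (dG) (dH) => G0 GL GR [H0 HL HR].
  have dG' p x : x \in opts p G -> dicot x by case: p; [exact: GL | exact: GR].
  have dH' p x : x \in opts p H -> dicot x by case: p; [exact: HL | exact: HR].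
  have dz p z : z \in opts p (gadd G H) -> dicot z.
    move=> /opts_gaddP[] [x xG ->].
      exact: (IHG _ _ xG _ (dG' _ _ xG) dH).
    exact: (IHH _ _ xG dG (dH' _ _ xG)).
  split; [|exact: (dz Left)|exact: (dz Right)].
  have e0 p :
      opts p (gadd G H) = fset0 <-> opts p G = fset0 /\ opts p H = fset0.
    rewrite opts_gadd; split=> [/eqP|[-> ->]]; last by rewrite !imfset0 fsetU0.
    by rewrite fsetU_eq0 !imfset_eq0 => /andP[/eqP-> /eqP->].
  split=> [/(proj1 (e0 Left))|/(proj1 (e0 Right))] [/G0 hG /H0 hH].
    exact: (proj2 (e0 Right)).
  exact: (proj2 (e0 Left)).
- elim/opts_ind => G IH [G0 GL GR]; split.
  + rewrite lopts_conjugate ropts_conjugate.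
    by split=> /eqP; rewrite imfset_eq0 => /eqP /G0 ->; rewrite imfset0.
  + move=> y; rewrite lopts_conjugate => /imfsetP[x /= xG ->].
    exact: (IH Right _ xG (GR _ xG)).
  + move=> y; rewrite ropts_conjugate => /imfsetP[x /= xG ->].
    exact: (IH Left _ xG (GL _ xG)).
- by move=> G x [_ GL _] /GL.
- by move=> G x [_ _ GR] /GR.
- move=> A B A0 B0 dA dB; split; rewrite ?lopts_Form ?ropts_Form //.
Qed.

(** * Absolute universes *)

Section AbsoluteUniverse.

Variables (U : form -> Prop) (absU : absolute_universe U).

Let univU : universe U := proj1 absU.
Let parU : parental U := proj2 absU.

Lemma universe_opt (p : player) (G x : form) : U G -> x \in opts p G -> U x.
Proof.
by case: p; [exact: (universe_lopt univU) | exact: (universe_ropt univU)].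
Qed.

(** A dicot other than [game0] has options for both players, so parentality rebuilds it from
    them. *)
Lemma included_dicot : included dicot U.
Proof.
elim/opts_ind => G IH [G0 GL GR]; rewrite -(form_eta G).
have [L0|/eqP L0] := eqVneq (lopts G) fset0.
  by rewrite L0; move/G0: L0 => ->; exact: (universe0 univU).
apply: parU => //; first by move/G0.
- by move=> x xG; exact: (IH Left _ xG (GL _ xG)).
- by move=> x xG; exact: (IH Right _ xG (GR _ xG)).
Qed.

(* With [K'] the conjugate of [K], a positive integer, [{0 | K' + K'}] is the
   simplest number strictly between [0] and [2 K' >= 2]. *)
Lemma negative_left_end_one (K : form) :
    U K -> opts Left K = fset0 -> wins_first Right K ->
  exists2 E, U E & equiv E (nat_form 1).
Proof.
move=> UK K0 wK; set K' := conjugate K; set N := conjugate (nat_form 1).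
have UK' : U K' by exact: (universe_conjugate univU).
have R0 : opts Right K' = fset0 by rewrite opts_conjugate K0 imfset0.
have wK' : wins_first Left K' by rewrite wins_first_conjugate.
(* Right's only move is from -1 to 0, leaving [K'], which Left wins moving first. *)
have sK'N : safe Left (gadd K' N).
  apply/safeP => z /opts_gaddP[] [x]; first by rewrite R0.
  by rewrite opts_opp1 => /fset1P-> ->; rewrite gadd0.
exists (Form [fset game0] [fset gadd K' K']).
  apply: parU.
  - by move/fsetP/(_ game0); rewrite !inE eqxx.
  - by move/fsetP/(_ (gadd K' K')); rewrite !inE eqxx.
  - by move=> x /fset1P->; exact: (universe0 univU).
  - by move=> x /fset1P->; exact: (universe_add univU).
rewrite -[nat_form 1]conjugateK; apply: equiv_opposite => -[];
  apply/safeP => z /opts_gaddP[] [x xz ->].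
- move: xz; rewrite opts_Form => /fset1P->.
  (* Regrouped as (K' - 1) + K': Left is safe in the first summand and wins the second moving
     first. *)
  by rewrite -gaddA gaddC; exact: wins_first_gadd.
- move: xz; rewrite opts_opp1 => /fset1P->; rewrite gadd0.
  by apply/wins_firstP; exists game0; rewrite ?safe_game0 // opts_Form inE.
- move: xz; rewrite opts_Form => /fset1P->.
  by rewrite gadd0l wins_first_Right_opp1.
- by rewrite opts_opp1 in xz.
Qed.

(** Ends are integers up to [equiv]; sums of copies of [E] and their conjugates represent all
    integers in [U]. *)
Lemma end_equiv_of_one (E : form) : U E -> equiv E (nat_form 1) ->
  forall p G, opts p G = fset0 -> exists2 H, U H & equiv G H.
Proof.
move=> UE e1; have natU n : exists2 H, U H & equiv (nat_form n) H.
  elim: n => [|n [H UH eH]].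
    by exists game0; first exact: (universe0 univU).
  exists (gadd E H); first exact: (universe_add univU).
  by rewrite -nat_formS; apply: equiv_gadd => //; exact: equiv_sym.
have leftU G : opts Left G = fset0 -> exists2 H, U H & equiv G H.
  move=> /left_end_equiv_nat_form[n eG]; have [H UH eH] := natU n.
  exists (conjugate H); first exact: (universe_conjugate univU).
  exact: equiv_trans eG (equiv_conjugate eH).
case=> // G G0; have [|H UH eH] := leftU (conjugate G).
  by rewrite opts_conjugate G0 imfset0.
exists (conjugate H); first exact: (universe_conjugate univU).
by rewrite -[G]conjugateK; exact: equiv_conjugate.
Qed.

End AbsoluteUniverse.

(** * Replacement of options and conclusion *)

(** The replacement argument, used from [Omega] into [U] and from [U] into [dicot]. Parentality
    handles forms with options on both sides, so only ends need a hypothesis. *)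
Lemma parental_equiv (P V : form -> Prop) :
    parental P ->
    (forall p G x, V G -> x \in opts p G -> V x) ->
    (forall p G, V G -> opts p G = fset0 -> exists2 H, P H & equiv G H) ->
  forall G, V G -> exists2 H, P H & equiv G H.
Proof.
move=> parP optV endV; elim/opts_ind => G IH VG.
have hopt p x : x \in opts p G -> exists2 y, P y & equiv x y.
  by move=> xG; exact: (IH _ _ xG (optV _ _ _ VG xG)).
have [L0|[l lG]] := fset_0Vmem (opts Left G); first exact: endV L0.
have [R0|[r rG]] := fset_0Vmem (opts Right G); first exact: endV R0.
have [A [AP GA AG]] := fset_choice (hopt Left).
have [B [BP GB BG]] := fset_choice (hopt Right).
exists (Form A B).
  apply: parP => //.
    by move=> A0; have [y] := GA _ lG; rewrite A0.
  by move=> B0; have [y] := GB _ rG; rewrite B0.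
apply: equiv_opts => -[] x; rewrite opts_Form.
- exact: GA.
- exact: GB.
- exact: AG.
- exact: BG.
Qed.

Lemma not_proper_extension (U V : form -> Prop) :
  (forall G, V G -> exists2 H, U H & equiv G H) -> ~ proper_extension U V.
Proof.
move=> h [_ [G [/h[H UH eGH] dG]]]; have [X [_]] := dG H UH.
by apply; exact: equiv_outcome.
Qed.

Theorem corollary15 :
  absolute_universe dicot /\
  proper_extension dicot Omega /\
  (forall U : form -> Prop,
     absolute_universe U -> proper_extension U Omega ->
     included dicot U /\ indist_extension dicot U).
Proof.
split; first exact: dicot_absolute.
split.
  (* The form 1 is told apart from every dicot by the context -1: whoever starts loses 1 - 1,
     whereas Right always wins [H] - 1. *)
  split=> //; exists (nat_form 1); split=> // H dH.
  exists (conjugate (nat_form 1)); split=> //; rewrite /outcome.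
  have z1 := zero_game_conjugate (nat_form 1).
  rewrite (negbTE (z1 Left)) (negbTE (z1 Right)).
  have [/negbTE -> ->] := dicot_lt_one dH.
  by [].
move=> U absU extU; split; first exact: included_dicot.
split; first exact: included_dicot.
(* If Right won such a [G] moving first, [U] would contain a form of value 1, hence an equivalent of
   every form, contradicting [extU]. *)
have end0 G : U G -> opts Left G = fset0 -> equiv G game0.
  move=> UG G0; apply: zero_game_equiv => -[]; last by apply/safeP; rewrite G0.
  apply/negP => wG; have [E UE e1] := negative_left_end_one absU UG G0 wG.
  apply: not_proper_extension extU; apply: parental_equiv => //.
    exact: proj2 absU.
  move=> p H _; exact: end_equiv_of_one e1 _ _.
apply: not_proper_extension; apply: parental_equiv.
- exact: proj2 dicot_absolute.
- exact: universe_opt.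
- move=> p G UG G0; exists game0; first exact: universe0 (proj1 dicot_absolute).
  case: p G0 => G0; first exact: end0.
  (* Forms without Right options reduce to [end0] by conjugation. *)
  rewrite -[G]conjugateK -conjugate_game0; apply: equiv_conjugate.
  apply: end0; first exact: universe_conjugate (proj1 absU) _ UG.
  by rewrite opts_conjugate G0 imfset0.
Qed.
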